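(* Let $\{\mathbb{S}_n\}_{n\geqslant0}$ be the monic orthogonal polynomial system associated with an $xy$-symmetric weight function $W$ on $\Omega\subset\mathbb{R}^2$, with three term relation coefficients $\Gamma_{n,k}$ ($k=1,2$), and let $\{\widehat{\mathbb{P}}_n^{(i,j)}\}_{n\geqslant0}$, $i,j\in\{0,1\}$, be the monic orthogonal polynomial systems associated with the weights $W^{(i,j)}(x,y)=\frac14x^iy^j\frac{1}{\sqrt{xy}}W(\sqrt{x},\sqrt{y})$ on $\Omega^*=\{(x,y):x,y\geqslant0,(\sqrt x,\sqrt y)\in\Omega\}$, with three term relation coefficients $\widehat{\mathrm{D}}_{n,k}^{(i,j)},\widehat{\mathrm{C}}_{n,k}^{(i,j)}$. Suppose these families are related by $$\mathbb{S}_{2n}(x,y)=\mathbb{P}_n^{(0,0)}(x^2,y^2)+x\,y\,\mathbb{P}_{n-1}^{(1,1)}(x^2,y^2),\qquad \mathbb{S}_{2n+1}(x,y)=x\,\mathbb{P}_n^{(1,0)}(x^2,y^2)+y\,\mathbb{P}_n^{(0,1)}(x^2,y^2),$$ where $\mathbb{P}_n^{(i,j)}=(\mathrm{J}_n^{(i,j)})^\top\,\widehat{\mathbb{P}}_n^{(i,j)}$. Then, for all $n\geqslant0$ and $k=1,2$, \begin{align*} \widehat{\mathrm{D}}_{n,k}^{(0,0)} &= \mathrm{J}_n^{(0,0)}[\mathrm{L}_{2n,k}\Gamma_{2n+1,k}+\Gamma_{2n,k}\mathrm{L}_{2n-1,k}](\mathrm{J}_n^{(0,0)})^\top, & \widehat{\mathrm{C}}_{n,k}^{(0,0)}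 &= \mathrm{J}_n^{(0,0)}\Gamma_{2n,k}\Gamma_{2n-1,k}(\mathrm{J}_{n-1}^{(0,0)})^\top,\\ \widehat{\mathrm{D}}_{n,k}^{(1,1)} &= \mathrm{J}_n^{(1,1)}[\mathrm{L}_{2n+2,k}\Gamma_{2n+3,k}+\Gamma_{2n+2,k}\mathrm{L}_{2n+1,k}](\mathrm{J}_n^{(1,1)})^\top, & \widehat{\mathrm{C}}_{n,k}^{(1,1)} &= \mathrm{J}_n^{(1,1)}\Gamma_{2n+2,k}\Gamma_{2n+1,k}(\mathrm{J}_{n-1}^{(1,1)})^\top,\\ \widehat{\mathrm{D}}_{n,k}^{(1,0)} &= \mathrm{J}_n^{(1,0)}[\mathrm{L}_{2n+1,k}\Gamma_{2n+2,k}+\Gamma_{2n+1,k}\mathrm{L}_{2n,k}](\mathrm{J}_n^{(1,0)})^\top, & \widehat{\mathrm{C}}_{n,k}^{(1,0)} &= \mathrm{J}_n^{(1,0)}\Gamma_{2n+1,k}\Gamma_{2n,k}(\mathrm{J}_{n-1}^{(1,0)})^\top,\\ \widehat{\mathrm{D}}_{n,k}^{(0,1)} &= \mathrm{J}_n^{(0,1)}[\mathrm{L}_{2n+1,k}\Gamma_{2n+2,k}+\Gamma_{2n+1,k}\mathrm{L}_{2n,k}](\mathrm{J}_n^{(0,1)})^\top, & \widehat{\mathrm{C}}_{n,k}^{(0,1)} &= \mathrm{J}_n^{(0,1)}\Gamma_{2n+1,k}\Gamma_{2n,k}(\mathrm{J}_{n-1}^{(0,1)})^\top, \end{align*} with the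 convention that matrices with negative indices are taken as zero matrices (so that any product containing one is zero).
   Context: Weight function on $\Omega\subset\mathbb{R}^2$: a nonnegative function $W$ on $\Omega$ with positive integral and all moments finite (defined up to null sets). It is $xy$-symmetric if $(x,y)\in\Omega$ implies $(-x,y),(x,-y)\in\Omega$, and $W(-x,y)=W(x,y)=W(x,-y)$ on $\Omega$. The monic orthogonal polynomial system (MOPS) associated with $W$ on $\Omega$ is the unique sequence of column vectors $\mathbb{P}_n=[P_{n,0},\dots,P_{n,n}]^\top$, $n\geqslant0$, of real bivariate polynomials with $P_{n,j}(x,y)=x^{n-j}y^j+(\text{polynomial of total degree}\leqslant n-1)$ and $\int_\Omega\mathbb{P}_n\mathbb{P}_m^\top W\,dx\,dy=0$ for $n\ne m$ (for $n=m$ this matrix is symmetric positive-definite). Write $x_1=x$, $x_2=y$. $\mathrm{L}_{n,1}=[\,I_{n+1}\mid 0\,]$ and $\mathrm{L}_{n,2}=[\,0\mid I_{n+1}\,]$ are $(n+1)\times(n+2)$ matrices. $\mathrm{J}_n^{(i,j)}$, $i,j\in\{0,1\}$, is the $(n+1)\times(2n+1+i+j)$ matrix whose entry (rows and columns indexed from $0$) in position $(h,2h+j)$ is $1$ for $0\leqslant h\leqslant n$, all other entries being $0$. Since $W$ is $xy$-symmetric, its MOPS satisfies $x_k\mathbb{S}_n=\mathrm{L}_{n,k}\mathbb{S}_{n+1}+\Gamma_{n,k}\mathbb{S}_{n-1}$ for $n\geqslant0$, $k=1,2$, with $\mathbb{S}_{-1}=0$ and, for $n\geqslant1$, $\Gamma_{n,k}=\mathbf{S}_n\mathrm{L}_{n-1,k}^\top\mathbf{S}_{n-1}^{-1}$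 of size $(n+1)\times n$, where $\mathbf{S}_n=\int_\Omega\mathbb{S}_n\mathbb{S}_n^\top W\,dx\,dy$. Terms containing $\Gamma_{0,k}$ are zero. Each MOPS $\{\widehat{\mathbb{P}}_n^{(i,j)}\}$ satisfies, for $n\geqslant0$ and $k=1,2$, $x_k\widehat{\mathbb{P}}_n^{(i,j)}=\mathrm{L}_{n,k}\widehat{\mathbb{P}}_{n+1}^{(i,j)}+\widehat{\mathrm{D}}_{n,k}^{(i,j)}\widehat{\mathbb{P}}_n^{(i,j)}+\widehat{\mathrm{C}}_{n,k}^{(i,j)}\widehat{\mathbb{P}}_{n-1}^{(i,j)}$ with unique real matrices $\widehat{\mathrm{D}}_{n,k}^{(i,j)}$ of size $(n+1)\times(n+1)$ and (for $n\geqslant1$) $\widehat{\mathrm{C}}_{n,k}^{(i,j)}$ of size $(n+1)\times n$; $\widehat{\mathbb{P}}_{-1}^{(i,j)}=0$ and $\widehat{\mathrm{C}}_{0,k}^{(i,j)}$ is taken as zero. Also $\mathbb{P}_{-1}^{(1,1)}=0$. *)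

(* Defs.v *)
From mathcomp Require Import all_boot all_order all_algebra.
From mathcomp Require Import all_classical all_reals all_analysis.
(* mpoly and mathcomp-analysis declare incompatible notations. *)
From mathcomp Require Import -(notations) mpoly.
Set Implicit Arguments.
Unset Strict Implicit.
Unset Printing Implicit Defensive.
Import Order.TTheory GRing.Theory Num.Theory.
Local Open Scope classical_set_scope.
Local Open Scope ring_scope.

Notation plane R := (measurableTypeR R * measurableTypeR R)%type.

Definition mu2 (R : realType) : {measure set (plane R) -> \bar R} :=
  (@lebesgue_measure R \x @lebesgue_measure R)%E.

(** Weights. A weight is only defined up to null sets, so pointwise conditions
    on it are required almost everywhere on [Omega]. *)
Section Weights.
Variable R : realType.
Implicit Types (Omega : set (plane R)) (W : plane R -> R).

Definition is_weight Omega W : Prop :=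
  [/\ measurable Omega,
      measurable_fun Omega W,
      {ae @mu2 R, forall z, Omega z -> 0 <= W z},
      forall a b : nat,
        (@mu2 R).-integrable Omega (fun z => (z.1 ^+ a * z.2 ^+ b * W z)%:E)
    & 0 < \int[@mu2 R]_(z in Omega) W z].

Definition xy_symmetric Omega W : Prop :=
  (forall x y : R, Omega (x, y) -> Omega (- x, y) /\ Omega (x, - y)) /\
  {ae @mu2 R, forall z, Omega z ->
     W (- z.1, z.2) = W z /\ W (z.1, - z.2) = W z}.

Definition Omega_star Omega : set (plane R) :=
  [set z | [/\ 0 <= z.1, 0 <= z.2 & Omega (Num.sqrt z.1, Num.sqrt z.2)]].

(* On the (null) axes, the junk value 0^-1 = 0 is used. *)
Definition W_star W (i j : bool) (z : plane R) : R :=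
  4^-1 * z.1 ^+ i * z.2 ^+ j * (Num.sqrt (z.1 * z.2))^-1
    * W (Num.sqrt z.1, Num.sqrt z.2).

End Weights.

Notation bipoly R := (mpoly 2 R).

(** The variable of index k : 'I_2 is x_(k+1), so that
    x = [var 0] and y = [var 1]. *)
Section Polynomials.
Variable R : realType.

Definition var (k : 'I_2) : bipoly R := mpolyX R (mnm1 k).

Definition cst (c : R) : bipoly R := mpolyC 2 c.

Definition ev (z : plane R) (p : bipoly R) : R :=
  meval (fun k : 'I_2 => if k == 0 then z.1 else z.2) p.

Definition subst_sq (p : bipoly R) : bipoly R :=
  comp_mpoly [tuple var k ^+ 2 | k < 2] p.

End Polynomials.

Definition polysys (R : realType) : Type := forall n : nat, 'cV[bipoly R]_n.+1.

(** A matrix of index n - 1, where index -1 stands for the zero matrix;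
    [p] and [q] give the dimensions, indexed so that A_(n-1) is p n x q n. *)
Definition prevmx (V : nmodType) (p q : nat -> nat)
    (A : forall n, 'M[V]_(p n.+1, q n.+1)) (n : nat) : 'M[V]_(p n, q n) :=
  match n with
  | 0 => 0
  | m.+1 => A m
  end.

Section Orthogonality.
Variable R : realType.
Implicit Types (Omega : set (plane R)) (W : plane R -> R) (P : polysys R).

Definition gram Omega W m n (u : 'cV[bipoly R]_m) (v : 'cV[bipoly R]_n) :
    'M[R]_(m, n) :=
  \matrix_(a, b) \int[@mu2 R]_(z in Omega) (ev z (u a 0 * v b 0) * W z).

Definition sym_posdef n (A : 'M[R]_n) : Prop :=
  A^T = A /\ forall v : 'cV[R]_n, v != 0 -> 0 < (v^T *m A *m v) 0 0.

(* [msize q <= n] means that q has total degree <= n - 1 (q = 0 for n = 0). *)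
Definition monic_sys P : Prop :=
  forall n (j : 'I_n.+1), exists q : bipoly R,
    (msize q <= n)%N /\ P n j 0 = var R 0 ^+ (n - j) * var R 1 ^+ j + q.

Definition is_mops Omega W P : Prop :=
  [/\ monic_sys P,
      forall n m, n <> m -> gram Omega W (P n) (P m) = 0
    & forall n, sym_posdef (gram Omega W (P n) (P n))].

End Orthogonality.

Section StructureMatrices.
Variable R : realType.

(** L_(n,k+1): [I | 0] for k = 0 and [0 | I] for k = 1. *)
Definition Lmx (k : 'I_2) (n : nat) : 'M[R]_(n.+1, n.+2) :=
  \matrix_(h, l) (l == h + k :> nat)%N%:R.

(** J_n^(i,j); the summands are ordered so that the number of columns reduces
    to n.*2.+1, n.*2.+2 or n.*2.+3 for concrete i and j. *)
Definition Jmx (i j : bool) (n : nat) : 'M[R]_(n.+1, (i + (j + n.*2)).+1) :=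
  \matrix_(h, l) (l == h.*2 + j :> nat)%N%:R.

(** Gamma_(n,k+1), for the system S associated with W on Omega. *)
Definition Gamma (Omega : set (plane R)) (W : plane R -> R) (S : polysys R)
    (k : 'I_2) (n : nat) : 'M[R]_(n.+1, n) :=
  match n with
  | 0 => 0
  | m.+1 => gram Omega W (S m.+1) (S m.+1) *m (Lmx k m)^T
              *m invmx (gram Omega W (S m) (S m))
  end.

Definition lift_mx m n (A : 'M[R]_(m, n)) : 'M[bipoly R]_(m, n) :=
  map_mx (@cst R) A.

(** The matrices D_(n,k+1) and C_(n,k+1) are the coefficients of the three term
    relations satisfied by P (C_(0,k+1) is an empty matrix). *)
Definition three_term (P : polysys R) (D : 'I_2 -> forall n : nat, 'M[R]_n.+1)
    (C : 'I_2 -> forall n : nat, 'M[R]_(n.+1, n)) : Prop :=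
  forall (k : 'I_2) (n : nat),
    var R k *: P n =
      lift_mx (Lmx k n) *m P n.+1 + lift_mx (D k n) *m P n
      + lift_mx (C k n) *m prevmx (p := id) (q := fun=> 1%N) P n.

(** P_n^(i,j), obtained from the system of the weight W^(i,j). *)
Definition bigP (i j : bool) (Phat : polysys R) (n : nat) :
    'cV[bipoly R]_((i + (j + n.*2)).+1) :=
  lift_mx (Jmx i j n)^T *m Phat n.

Definition subst_sq_mx m (u : 'cV[bipoly R]_m) : 'cV[bipoly R]_m :=
  map_mx (@subst_sq R) u.

End StructureMatrices.

(* Main.v *)
Require Import Defs.
From mathcomp Require Import all_boot all_order all_algebra.
From mathcomp Require Import all_classical all_reals all_analysis.
From mathcomp Require Import -(notations) mpoly.
From mathcomp Require Import zify.
From HB Require Import structures.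
Set Implicit Arguments.
Unset Strict Implicit.
Unset Printing Implicit Defensive.
Import Order.TTheory GRing.Theory Num.Theory.
Local Open Scope ring_scope.

(** The polynomials S_n have the parity of n, by their very expression through
    the families P^(i,j), and this yields the three term relation without a
    diagonal term, x_k S_n = L_(n,k) S_(n+1) + Gamma_(n,k) S_(n-1). Applying it
    twice expresses x_k^2 S_m through S_(m+2), S_m and S_(m-2). The monomials
    whose exponents have parities (i, j) form a summand that is stable under
    multiplication by x_k^2; projecting on it turns the last relation into one
    for P^(i,j), and multiplication by J_n^(i,j) turns it into one for the monic
    system Phat^(i,j), whose coefficients are unique. *)

(** * Coefficients, parity, and the parts of a polynomial by parity of exponents *)

Section Monomials.
Variable R : realType.
Implicit Types (p q : bipoly R) (m : multinom 2) (i j : bool) (k : 'I_2).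

Lemma mnm2P m m' : m 0%R = m' 0%R -> m 1%R = m' 1%R -> m = m'.
Proof.
move=> e0 e1; apply/mnmP => k.
by case: k => [[|[|//]] lt]; [have -> : Ordinal lt = 0 by exact: val_inj
  | have -> : Ordinal lt = 1 by exact: val_inj].
Qed.

Lemma mdeg2 m : mdeg m = (m 0%R + m 1%R)%N.
Proof. by rewrite mdegE big_ord_recl big_ord1; congr (_ + m _)%N; apply: val_inj. Qed.

Definition mnm2 (a b : nat) : multinom 2 := Multinom [tuple a; b].

Lemma mnm20 a b : mnm2 a b 0%R = a. Proof. by []. Qed.
Lemma mnm21 a b : mnm2 a b 1%R = b. Proof. by []. Qed.

Lemma mpolyX2 m : mpolyX R m = var R 0 ^+ m 0%R * var R 1 ^+ m 1%R.
Proof.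
rewrite !mpolyXn -mpolyXD; congr mpolyX; apply: mnm2P;
by rewrite mnmDE !mulmnE !mnm1E /= ?mul1n ?mul0n ?addn0.
Qed.

Lemma subm1K m k : m k != 0%N -> mnm_add (mnm_sub m (mnm1 k)) (mnm1 k) = m.
Proof.
move=> mk; rewrite submK //; apply/mnm_lepP => l.
by rewrite mnm1E; case: eqP => // <-; lia.
Qed.

Lemma mdeg_subm1 m k : m k != 0%N -> mdeg m = (mdeg (mnm_sub m (mnm1 k))).+1.
Proof. by move=> mk; rewrite -{1}(subm1K mk) mdegD mdeg1 addn1. Qed.

(** [mnm_sub] truncates at zero, hence the separate case of a monomial that the variable does not
    divide. *)
Lemma mcoeff_varM k p m :
  mcoeff m (var R k * p) = if m k == 0%N then 0 else mcoeff (mnm_sub m (mnm1 k)) p.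
Proof.
rewrite mulrC; case: eqVneq => mk.
  apply/eqP; rewrite mcoeff_eq0 (perm_mem (msuppMX _ _)).
  by apply/mapP => -[m' _ em]; move: mk; rewrite em mnmDE mnm1E eqxx.
by rewrite -[in LHS](subm1K mk) addmC mcoeffMX.
Qed.

(** Degree bounds are put on coefficients, so that they pass termwise through linear combinations;
    for n = 0 the bound forces p = 0. *)
Definition deg_lt n p : Prop := forall m, (n <= mdeg m)%N -> mcoeff m p = 0.

Lemma msize_deg_lt n p : (msize p <= n)%N -> deg_lt n p.
Proof.
move=> pn m nm; apply/eqP; rewrite mcoeff_eq0; apply: msize_mdeg_ge.
exact: leq_trans nm.
Qed.

Lemma deg_ltW n n' p : (n <= n')%N -> deg_lt n p -> deg_lt n' p.
Proof. by move=> nn' pn m /(leq_trans nn'); apply: pn. Qed.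

Lemma deg_lt0 p : deg_lt 0 p -> p = 0.
Proof. by move=> p0; apply/mpolyP => m; rewrite p0 ?mcoeff0. Qed.

Lemma deg_ltN n p : deg_lt n p -> deg_lt n (- p).
Proof. by move=> pn m nm; rewrite mcoeffN pn // oppr0. Qed.

Lemma deg_ltD n p q : deg_lt n p -> deg_lt n q -> deg_lt n (p + q).
Proof. by move=> pn qn m nm; rewrite mcoeffD pn // qn // addr0. Qed.

Definition parity b p : Prop :=
  forall m, odd (mdeg m) != b -> mcoeff m p = 0.

Lemma parity_varM b k p : parity b p -> parity (~~ b) (var R k * p).
Proof.
move=> pb m mb; rewrite mcoeff_varM; case: eqVneq => // mk; apply: pb.
by move: mb; rewrite (mdeg_subm1 mk) /=; case: (odd _); case: b.
Qed.

(** Parity rules out the monomials of degree exactly n. This gain of one degree is what removes the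
    diagonal term from the recurrence of S. *)
Lemma deg_lt_parity n p : deg_lt n.+1 p -> parity (~~ odd n) p -> deg_lt n p.
Proof.
move=> pn pp m; rewrite leq_eqVlt => /predU1P[nm|]; last exact: pn.
by apply: pp; rewrite -nm; case: odd.
Qed.

(** The exponent of x^i y^j times the monomial m taken at (x^2, y^2). *)
Definition dbl i j m : multinom 2 := mnm2 (m 0%R * 2 + i) (m 1%R * 2 + j).

Lemma dbl_inj i j i' j' m m' :
  (dbl i j m == dbl i' j' m') = [&& i == i', j == j' & m == m'].
Proof.
apply/eqP/and3P => [e|[/eqP-> /eqP-> /eqP->]//].
have: dbl i j m 0%R = dbl i' j' m' 0%R by rewrite e.
have: dbl i j m 1%R = dbl i' j' m' 1%R by rewrite e.
rewrite !mnm20 !mnm21 => e1 e0.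
have [ei ej] : i = i' /\ j = j' by split; lia.
by split; apply/eqP => //; apply: mnm2P; lia.
Qed.

Lemma mdeg_dbl i j m : odd (mdeg (dbl i j m)) = i (+) j.
Proof. by rewrite mdeg2 mnm20 mnm21 !oddD !oddM !andbF /= !oddb. Qed.

Lemma dbl_half m :
  m = dbl (odd (m 0%R)) (odd (m 1%R)) (mnm2 (m 0%R)./2 (m 1%R)./2).
Proof. by apply: mnm2P; rewrite !(mnm20, mnm21) muln2 addnC odd_double_half. Qed.

Definition lift_sq i j p : bipoly R := var R 0 ^+ i * var R 1 ^+ j * subst_sq p.

Lemma lift_sqE i j p :
  lift_sq i j p = \sum_(m <- msupp p) mcoeff m p *: mpolyX R (dbl i j m).
Proof.
rewrite /lift_sq {1}[p]mpolyE /subst_sq raddf_sum mulr_sumr /=.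
apply: eq_bigr => m _; rewrite comp_mpolyZ comp_mpolyX -scalerAr; congr (_ *: _).
rewrite big_ord_recl big_ord1 !tnth_mktuple [RHS]mpolyX2 mnm20 mnm21.
have -> : lift ord0 ord0 = 1 :> 'I_2 by exact: val_inj.
by rewrite -!exprM ![(2 * _)%N]mulnC mulrACA -!exprD ![(_ * 2 + _)%N]addnC.
Qed.

Lemma parity_lift_sq i j p : parity (i (+) j) (lift_sq i j p).
Proof.
move=> m mij; rewrite lift_sqE raddf_sum big1 //= => m' _.
rewrite mcoeffZ mcoeffX; case: eqP => [em|_]; last by rewrite mulr0.
by rewrite -em mdeg_dbl eqxx in mij.
Qed.

(* The polynomial q for which [lift_sq i j q] is the sum of the terms of p with
   x-exponent of parity i and y-exponent of parity j. *)
Definition part_sq i j p : bipoly R :=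
  \sum_(m <- msupp p | (odd (m 0%R) == i) && (odd (m 1%R) == j))
     mcoeff m p *: mpolyX R (mnm2 (m 0%R)./2 (m 1%R)./2).

(** Every exponent is [dbl] of its two parities and its halves, in one way only. This describes
    [part_sq] without the support of p, so that its linearity can be checked on coefficients. *)
Lemma mcoeff_part_sq i j p m : mcoeff m (part_sq i j p) = mcoeff (dbl i j m) p.
Proof.
rewrite [in RHS](mpolyE p) /part_sq !raddf_sum big_mkcond /=.
apply: eq_bigr => m' _; rewrite !mcoeffZ !mcoeffX [in RHS](dbl_half m') dbl_inj.
rewrite -dbl_half.
by case: (_ == i); case: (_ == j); rewrite /= ?mulr0.
Qed.

Fact part_sq_is_linear i j : linear (part_sq i j).
Proof.
move=> c p q; apply/mpolyP => m.
by rewrite !(mcoeffD, mcoeffZ, mcoeff_part_sq).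
Qed.

HB.instance Definition _ i j :=
  GRing.isLinear.Build R (bipoly R) (bipoly R) *:%R (part_sq i j)
    (part_sq_is_linear i j).

(** Multiplication by the square of a variable raises its exponent by 2, which keeps the parity and
    raises the half by 1. *)
Lemma part_sq_varM i j k p :
  part_sq i j (var R k ^+ 2 * p) = var R k * part_sq i j p.
Proof.
apply/mpolyP => m; rewrite mcoeff_part_sq expr2 -mulrA !mcoeff_varM mnmBE mnm1E eqxx.
(* [b] is i or j, whichever belongs to the variable of index k. *)
have [b dk] : exists b : bool, dbl i j m k = (m k * 2 + b)%N.
  by case: k => [[|[|//]] lt] /=;
    [exists i; have -> : Ordinal lt = 0 by exact: val_inj
    | exists j; have -> : Ordinal lt = 1 by exact: val_inj].
have [mk|mk] := eqVneq (m k) 0%N.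
  (* The exponent is b <= 1, so the square of the variable does not divide the monomial. *)
  by rewrite dk mk; case: b {dk}.
rewrite mcoeff_part_sq dk.
(* Since m k > 0, the exponent is at least 2 and both subtractions of 1 are genuine. *)
have -> : (m k * 2 + b == 0)%N = false by lia.
have -> : (m k * 2 + b - 1 == 0)%N = false by lia.
congr (mcoeff _ p); apply: mnm2P;
  rewrite !(mnm20, mnm21, mnmBE, mnm1E); move: mk {dk}.
  by have [->|_] := eqVneq k 0%R; lia.
by have [->|_] := eqVneq k 1%R; lia.
Qed.

Lemma part_sq_lift_sq i j i' j' p :
  part_sq i j (lift_sq i' j' p) = if (i == i') && (j == j') then p else 0.
Proof.
apply/mpolyP => m; rewrite mcoeff_part_sq lift_sqE raddf_sum /=.
rewrite [in RHS](mpolyE p) (fun_if (mcoeff m)) raddf_sum mcoeff0 /=.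
case: ifP => e; last first.
  rewrite big1 // => m' _; rewrite mcoeffZ mcoeffX dbl_inj.
  by rewrite (eq_sym i') (eq_sym j') andbA e mulr0.
case/andP: e => /eqP-> /eqP->.
by apply: eq_bigr => m' _; rewrite !mcoeffZ !mcoeffX dbl_inj !eqxx.
Qed.

End Monomials.

(** * Monic systems and uniqueness of three term coefficients *)

Section MonicSystems.
Variable R : realType.
Implicit Types (p q : bipoly R) (P : polysys R) (k : 'I_2).

(** Among the monomials of degree n, the y-exponent alone identifies the monomial. *)
Lemma mcoeff_monic P n (j : 'I_n.+1) (m : multinom 2) : monic_sys P ->
  (n <= mdeg m)%N ->
  mcoeff m (P n j 0) = ((mdeg m == n) && (m 1%R == j :> nat))%:R.
Proof.
move=> Pm nm; have [q [/msize_deg_lt qn ->]] := Pm n j.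
have -> : var R 0 ^+ (n - j) * var R 1 ^+ j = mpolyX R (mnm2 (n - j) j).
  by rewrite mpolyX2 mnm20 mnm21.
rewrite mcoeffD qn // addr0 mcoeffX; congr (nat_of_bool _)%:R.
apply/eqP/andP => [<-|[/eqP mn /eqP mj]].
  by rewrite mdeg2 mnm20 mnm21 subnK // -ltnS.
by apply: mnm2P; rewrite !(mnm20, mnm21) -mj // -mn mdeg2 addnK.
Qed.

Lemma deg_lt_monic P n (j : 'I_n.+1) : monic_sys P -> deg_lt n.+1 (P n j 0).
Proof. by move=> Pm m nm; rewrite mcoeff_monic 1?ltnW // gtn_eqF. Qed.

Lemma lift_mxE m n (A : 'M[R]_(m, n)) (u : 'cV[bipoly R]_n) i :
  (lift_mx A *m u) i 0 = \sum_l A i l *: u l 0.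
Proof. by rewrite mxE; apply: eq_bigr => l _; rewrite mxE /cst mul_mpolyC. Qed.

Lemma lift_mxM m n l (A : 'M[R]_(m, n)) (B : 'M[R]_(n, l)) :
  lift_mx (A *m B) = lift_mx A *m lift_mx B.
Proof. exact: (map_mxM (@mpolyC 2 R)). Qed.

Lemma lift_mxD m n (A B : 'M[R]_(m, n)) : lift_mx (A + B) = lift_mx A + lift_mx B.
Proof. exact: (map_mxD (@mpolyC 2 R)). Qed.

Lemma lift_mxB m n (A B : 'M[R]_(m, n)) : lift_mx (A - B) = lift_mx A - lift_mx B.
Proof. exact: (map_mxB (@mpolyC 2 R)). Qed.

Lemma lift_mx1 n : lift_mx (1%:M : 'M[R]_n) = 1%:M.
Proof. exact: (map_mx1 (@mpolyC 2 R)). Qed.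

Lemma lift_mx0 m n : lift_mx (0 : 'M[R]_(m, n)) = 0.
Proof. exact: (map_mx0 (@mpolyC 2 R)). Qed.

Lemma deg_lt_lift_mx n m l (A : 'M[R]_(m, l)) (u : 'cV[bipoly R]_l) i :
  (forall h, deg_lt n (u h 0)) -> deg_lt n ((lift_mx A *m u) i 0).
Proof.
move=> un m' nm'; rewrite lift_mxE raddf_sum big1 //= => h _.
by rewrite mcoeffZ un // mulr0.
Qed.

Lemma parity_lift_mx b m l (A : 'M[R]_(m, l)) (u : 'cV[bipoly R]_l) i :
  (forall h, parity b (u h 0)) -> parity b ((lift_mx A *m u) i 0).
Proof.
move=> ub m' bm'; rewrite lift_mxE raddf_sum big1 //= => h _.
by rewrite mcoeffZ ub // mulr0.
Qed.

(** The leading coefficients of [P n] form the identity matrix, so A can be read off the terms of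
    degree n. *)
Lemma mcoeff_lift_monic P m n (A : 'M[R]_(m, n.+1)) i (j : 'I_n.+1) :
  monic_sys P -> mcoeff (mnm2 (n - j) j) ((lift_mx A *m P n) i 0) = A i j.
Proof.
move=> Pm; have dn : mdeg (mnm2 (n - j) j) = n.
  by rewrite mdeg2 mnm20 mnm21 subnK // -ltnS.
rewrite lift_mxE raddf_sum (bigD1 j) //= mcoeffZ mcoeff_monic ?dn // mnm21 !eqxx.
rewrite big1 ?addr0 ?mulr1 // => l lj.
rewrite mcoeffZ mcoeff_monic ?dn // mnm21 eqxx /=.
by rewrite eq_sym -(inj_eq val_inj) in lj; rewrite (negbTE lj) mulr0.
Qed.

Lemma lift_monic_eq0 P m n (A : 'M[R]_(m, n.+1)) (u : 'cV[bipoly R]_m) :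
  monic_sys P -> (forall i, deg_lt n (u i 0)) -> lift_mx A *m P n + u = 0 -> A = 0.
Proof.
move=> Pm un /matrixP eq0; apply/matrixP => i j; rewrite mxE.
rewrite -(mcoeff_lift_monic A i j Pm).
have /(congr1 (mcoeff (mnm2 (n - j) j))) := eq0 i 0.
rewrite !mxE mcoeffD mcoeff0 un ?addr0 //.
by rewrite mdeg2 mnm20 mnm21 subnK // -ltnS.
Qed.

(** The leading terms are peeled off by decreasing degree: degree n + 1 gives A = 0, then degree n
    gives D = 0, then degree n - 1 gives C = 0. *)
Lemma three_term_coef_eq0 P n (D : 'M[R]_n.+1) (C : 'M[R]_(n.+1, n))
    (A : 'M[R]_(n.+1, n.+2)) : monic_sys P ->
  lift_mx A *m P n.+1 + lift_mx D *m P n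
    + lift_mx C *m prevmx (p := id) (q := fun=> 1%N) P n = 0 ->
  D = 0 /\ C = 0.
Proof.
move=> Pm; have prev_lt l : deg_lt n (prevmx (p := id) (q := fun=> 1%N) P n l 0).
  by case: n l {D C A} => [[]//|n] l; apply: deg_lt_monic.
have P_lt l : deg_lt n.+1 (P n l 0) by exact: deg_lt_monic.
rewrite -addrA => eq0; have A0 := eq0; move/(lift_monic_eq0 Pm) in A0.
rewrite A0 ?lift_mx0 ?mul0mx ?add0r in eq0; last first.
  move=> i; rewrite mxE; apply: deg_ltD; apply: deg_lt_lift_mx => // l.
  exact: deg_ltW (prev_lt l).
have D0 := eq0; move/(lift_monic_eq0 Pm) in D0.
rewrite D0 ?lift_mx0 ?mul0mx ?add0r in eq0; last by move=> i; apply: deg_lt_lift_mx.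
split; first by apply: D0 => i; apply: deg_lt_lift_mx.
(* For n = 0 the matrix C has no columns. *)
case: n C eq0 {D A prev_lt P_lt A0 D0} => [|n] C eq0; first exact: thinmx0.
apply: (@lift_monic_eq0 P _ _ C 0) => //; last by rewrite addr0.
by move=> i m _; rewrite mxE mcoeff0.
Qed.

(** Multiplying the leading monomial of entry i by the variable of index k gives the leading
    monomial of entry i + k of [P n.+1], which is the one selected by row i of [Lmx]; the terms of
    degree n + 1 cancel. *)
Lemma deg_lt_var_monic P k n (i : 'I_n.+1) : monic_sys P ->
  deg_lt n.+1 ((var R k *: P n - lift_mx (Lmx R k n) *m P n.+1) i 0).
Proof.
move=> Pm m nm; rewrite mxE [(- _ : 'cV__) _ _]mxE mxE lift_mxE mcoeffB raddf_sum /=.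
have ik : (i + k < n.+2)%N by have := ltn_ord i; have := ltn_ord k; lia.
rewrite (bigD1 (Ordinal ik)) //= mxE eqxx scale1r big1 ?addr0 => [|l lk]; last first.
  by rewrite mxE -(inj_eq val_inj) /= in lk *; rewrite (negbTE lk) scale0r mcoeff0.
rewrite mcoeff_varM [mcoeff m (P n.+1 _ _)]mcoeff_monic //=.
have m01 := mdeg2 m.
case: eqP => mk.
  (* The leading monomial of entry i + k of [P n.+1] is divisible by the variable of index k, so it
     cannot be m. *)
  case: andP => [[/eqP mn /eqP /= m1k]|_]; last by rewrite subr0.
  move: (ltn_ord i) m1k mk => lti {ik}; case: k => [[|[|//]] lt] /=.
    by rewrite (_ : Ordinal lt = 0); [lia|exact: val_inj].
  by rewrite (_ : Ordinal lt = 1); [lia|exact: val_inj].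
have dm := mdeg_subm1 (introN eqP mk).
rewrite mcoeff_monic //; last by rewrite -ltnS -dm.
apply/eqP; rewrite subr_eq0; apply/eqP; congr (nat_of_bool _)%:R.
rewrite dm eqSS mnmBE mnm1E; congr (_ && _).
case: k {ik dm} mk => [[|[|//]] lt] /=; last first.
  by rewrite (_ : Ordinal lt = 1); [lia|exact: val_inj].
by rewrite (_ : Ordinal lt = 0); [lia|exact: val_inj].
Qed.

End MonicSystems.

(** * Orthogonality for a linear functional and the symmetric three term relation *)

Section OrthogonalSystems.
Variables (R : realType) (Lf : {scalar bipoly R}).
Implicit Types (p q : bipoly R) (k : 'I_2).

(** The counterpart of [gram] with integration against W replaced by a linear functional, which
    leaves pure algebra. *)
Definition fgram m n (u : 'cV[bipoly R]_m) (v : 'cV[bipoly R]_n) : 'M[R]_(m, n) :=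
  \matrix_(a, b) Lf (u a 0 * v b 0).

Lemma fgramDl m n (u u' : 'cV[bipoly R]_m) (v : 'cV[bipoly R]_n) :
  fgram (u + u') v = fgram u v + fgram u' v.
Proof. by apply/matrixP => a b; rewrite !mxE mulrDl raddfD. Qed.

Lemma fgramNl m n (u : 'cV[bipoly R]_m) (v : 'cV[bipoly R]_n) :
  fgram (- u) v = - fgram u v.
Proof. by apply/matrixP => a b; rewrite !mxE mulNr raddfN. Qed.

Lemma fgramDr m n (u : 'cV[bipoly R]_m) (v v' : 'cV[bipoly R]_n) :
  fgram u (v + v') = fgram u v + fgram u v'.
Proof. by apply/matrixP => a b; rewrite !mxE mulrDr raddfD. Qed.

(** Multiplication by a polynomial is self-adjoint for the pairing (p, q) -> Lf (p q). *)
Lemma fgramZ m n p (u : 'cV[bipoly R]_m) (v : 'cV[bipoly R]_n) :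
  fgram (p *: u) v = fgram u (p *: v).
Proof. by apply/matrixP => a b; rewrite !mxE mulrCA mulrA. Qed.

Lemma fgram_mulmxl m n l (A : 'M[R]_(m, n)) (u : 'cV[bipoly R]_n) (v : 'cV[bipoly R]_l) :
  fgram (lift_mx A *m u) v = A *m fgram u v.
Proof.
apply/matrixP => a b; rewrite !mxE mulr_suml raddf_sum; apply: eq_bigr => h _ /=.
by rewrite !mxE /cst mul_mpolyC -scalerAl linearZ.
Qed.

Lemma fgram_mulmxr m n l (A : 'M[R]_(m, n)) (u : 'cV[bipoly R]_n) (v : 'cV[bipoly R]_l) :
  fgram v (lift_mx A *m u) = fgram v u *m A^T.
Proof.
apply/matrixP => a b; rewrite !mxE mulr_sumr raddf_sum; apply: eq_bigr => h _ /=.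
by rewrite !mxE /cst mul_mpolyC -scalerAr linearZ /= mulrC.
Qed.

Variable S : polysys R.
Hypothesis S_monic : monic_sys S.
Hypothesis S_orth : forall n m, n <> m -> fgram (S n) (S m) = 0.
Hypothesis S_unit : forall n, fgram (S n) (S n) \in unitmx.

Lemma orth_S n m (i : 'I_n.+1) (j : 'I_m.+1) : n <> m -> Lf (S n i 0 * S m j 0) = 0.
Proof. by move=> /S_orth/matrixP/(_ i j); rewrite !mxE. Qed.

Definition top_coef n p : 'rV[R]_n.+1 := \row_j mcoeff (mnm2 (n - j) j) p.

(** The combination of the entries of [S n] has the same terms of degree n as p, because [S n] is
    monic. *)
Lemma deg_lt_sub_top n p : deg_lt n.+1 p ->
  deg_lt n (p - \sum_j top_coef n p 0 j *: S n j 0).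
Proof.
move=> pn m; rewrite leq_eqVlt => /predU1P[nm|nm]; last first.
  rewrite mcoeffB pn // raddf_sum big1 ?subr0 //= => j _.
  by rewrite mcoeffZ (deg_lt_monic j S_monic) // mulr0.
have m1 : (m 1%R < n.+1)%N by rewrite nm ltnS mdeg2 leq_addl.
rewrite mcoeffB raddf_sum (bigD1 (Ordinal m1)) //= mcoeffZ mcoeff_monic ?nm //.
rewrite -nm !eqxx mulr1 mxE /= big1 ?addr0 => [|j jm]; last first.
  rewrite mcoeffZ mcoeff_monic ?nm //.
  by rewrite eq_sym -(inj_eq val_inj) /= in jm; rewrite (negbTE jm) andbF mulr0.
suff -> : mnm2 (n - m 1%R) (m 1%R) = m by rewrite subrr.
by apply: mnm2P; rewrite !(mnm20, mnm21) // nm mdeg2 addnK.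
Qed.

(** Induction on the degree: subtracting a combination of [S m] with m < n, already orthogonal to
    [S n], lowers the degree. *)
Lemma orth_lower n m p (i : 'I_n.+1) : (m <= n)%N -> deg_lt m p -> Lf (p * S n i 0) = 0.
Proof.
elim: m p => [|m IH] p mn pm; first by rewrite (deg_lt0 pm) mul0r raddf0.
have /(IH _ (ltnW mn)) := deg_lt_sub_top pm.
rewrite mulrBl raddfB /= mulr_suml raddf_sum big1 ?subr0 //= => j _.
by rewrite -scalerAl linearZ /= orth_S ?mulr0 // => mn'; rewrite mn' ltnn in mn.
Qed.

(** The invertible Gram matrices force the top coefficients of p to vanish, one degree at a time
    from above. *)
Lemma orth_eq0 n p : deg_lt n p ->
  (forall m (i : 'I_m.+1), (m < n)%N -> Lf (p * S m i 0) = 0) -> p = 0.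
Proof.
elim: n p => [|n IH] p pn orth_p; first exact: deg_lt0.
have sub_lt := deg_lt_sub_top pn.
suff c0 : top_coef n p = 0.
  apply: IH => [|m i mn]; last by rewrite orth_p // ltnW.
  by move: sub_lt; rewrite c0 big1 ?subr0 // => j _; rewrite mxE scale0r.
(* The entries of [top_coef n p] times the Gram matrix are the pairings of p with [S n], since the
   rest of p has lower degree and is orthogonal to [S n]. *)
apply: (can_inj (mulmxK (S_unit n))); rewrite mul0mx; apply/rowP => i; rewrite !mxE.
have := orth_lower i (leqnn n) sub_lt.
rewrite mulrBl raddfB /= orth_p // sub0r => /eqP; rewrite oppr_eq0 mulr_suml raddf_sum.
move/eqP; apply: etrans; apply: eq_bigr => j _.
by rewrite [fgram _ _ _ _]mxE -scalerAl /= linearZ.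
Qed.

Definition fGamma k n : 'M[R]_(n.+1, n) :=
  match n with
  | 0 => 0
  | m.+1 => fgram (S m.+1) (S m.+1) *m (Lmx R k m)^T *m invmx (fgram (S m) (S m))
  end.

Hypothesis S_parity : forall n (i : 'I_n.+1), parity (odd n) (S n i 0).

(** The difference r of the two sides has degree below n and is orthogonal to every [S m] with m <
    n, hence vanishes. *)
Lemma symmetric_three_term k n :
  var R k *: S n = lift_mx (Lmx R k n) *m S n.+1
    + lift_mx (fGamma k n) *m prevmx (p := id) (q := fun=> 1%N) S n.
Proof.
set prev := prevmx _ _.
apply/eqP; rewrite -subr_eq0 opprD addrA; set r := _ - _.
suff r0 i : r i 0 = 0 by apply/eqP/colP => i; rewrite r0 mxE.
apply: (@orth_eq0 n).
  (* Monicity only bounds the degree of r by n; all terms of r have parity opposite to n, which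
     excludes degree n. *)
  apply: deg_lt_parity.
    rewrite mxE; apply: deg_ltD; first exact: deg_lt_var_monic.
    rewrite mxE; apply/deg_ltN/deg_lt_lift_mx.
    rewrite /prev; case: (n) => [[]//|n'] l.
    by apply: deg_ltW (deg_lt_monic l S_monic); apply: leqnSn.
  have odd_D p q : parity (~~ odd n) p -> parity (~~ odd n) q -> parity (~~ odd n) (p - q).
    by move=> po qo m mo; rewrite mcoeffB po // qo // subr0.
  rewrite mxE [(- _ : 'cV__) _ _]mxE; apply: (odd_D).
    rewrite mxE [(- _ : 'cV__) _ _]mxE; apply: (odd_D).
      by rewrite mxE; apply/parity_varM/S_parity.
    by apply: parity_lift_mx => l; apply: (@S_parity n.+1).
  apply: parity_lift_mx; rewrite /prev; case: (n) => [[]//|n'] l.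
  by rewrite /= negbK; apply: S_parity.
move=> m j mn.
suff /matrixP/(_ i j) : fgram r (S m) = 0 by rewrite !mxE.
rewrite /r !fgramDl !fgramNl !fgram_mulmxl S_orth ?mulmx0 ?subr0; last first.
  by move=> nm; rewrite -nm ltnNge leqnSn in mn.
(* The second argument has degree at most m < n. *)
have low0 : fgram (S n) (var R k *: S m - lift_mx (Lmx R k m) *m S m.+1) = 0.
  apply/matrixP => a b; rewrite [LHS]mxE [RHS]mxE mulrC.
  by apply: (orth_lower a mn); apply: deg_lt_var_monic.
rewrite fgramZ -[X in fgram _ X](subrK (lift_mx (Lmx R k m) *m S m.+1)) fgramDr.
rewrite low0 add0r fgram_mulmxr.
(* With n now standing for n - 1: for m = n the two remaining terms cancel by the formula for
   [fGamma], and for m < n both vanish by orthogonality. *)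
rewrite /prev; case: n mn {i r prev low0} => // n; rewrite ltnS leq_eqVlt => /predU1P[->|mn] /=.
  by rewrite mulmxKV ?subrr.
rewrite [fgram (S n.+1) (S m.+1)]S_orth ?[fgram (S n) (S m)]S_orth; try lia.
by rewrite mul0mx mulmx0 subr0.
Qed.

End OrthogonalSystems.

(** * The recurrence for squared variables and its restriction to one parity class *)

Section SquareRecurrence.
Variables (R : realType) (S : polysys R) (G : 'I_2 -> forall n : nat, 'M[R]_(n.+1, n)).
Implicit Types (k : 'I_2).

Hypothesis S_rec : forall k n,
  var R k *: S n = lift_mx (Lmx R k n) *m S n.+1
    + lift_mx (G k n) *m prevmx (p := id) (q := fun=> 1%N) S n.

(* S_(n-2), as an empty column for n < 2. *)
Definition prev2 n : 'cV[bipoly R]_n.-1 :=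
  match n with m.+2 => S m | _ => 0 end.

Lemma square_recurrence k n :
  var R k ^+ 2 *: S n =
    lift_mx (Lmx R k n *m Lmx R k n.+1) *m S n.+2
    + lift_mx (Lmx R k n *m G k n.+1
               + G k n *m prevmx (p := id) (q := succn) (Lmx R k) n) *m S n
    + lift_mx (G k n *m prevmx (p := id) (q := predn) (G k) n) *m prev2 n.
Proof.
rewrite expr2 -scalerA S_rec scalerDr !scalemxAr S_rec mulmxDr !mulmxA -!lift_mxM.
rewrite lift_mxD mulmxDl -!addrA; congr (_ + (_ + _)).
(* For n = 0 every term of index n - 1 is zero. *)
case: n => [|n] /=.
  by rewrite scaler0 !mulmx0 lift_mx0 !mul0mx addr0.
by rewrite S_rec mulmxDr !mulmxA -!lift_mxM; congr (_ + _).
Qed.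

(** Here f plays the role of [part_sq i j] and m that of 2n + i + j, so that one argument serves the
    four pairs (i, j). As [J0] cancels its transpose, f followed by [J0] turns [S m] into [P n]. *)
Lemma decimated_coefs (f : {linear bipoly R -> bipoly R}) (P : polysys R) k n m
    (D : 'M[R]_n.+1) (C : 'M[R]_(n.+1, n))
    (J0 : 'M[R]_(n.+1, m.+1)) (J1 : 'M[R]_(n.+2, m.+3)) (J' : 'M[R]_(n, m.-1)) :
  (forall p, f (var R k ^+ 2 * p) = var R k * f p) ->
  monic_sys P ->
  var R k *: P n = lift_mx (Lmx R k n) *m P n.+1 + lift_mx D *m P n
    + lift_mx C *m prevmx (p := id) (q := fun=> 1%N) P n ->
  J0 *m J0^T = 1%:M ->
  map_mx f (S m) = lift_mx J0^T *m P n ->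
  map_mx f (S m.+2) = lift_mx J1^T *m P n.+1 ->
  map_mx f (prev2 m) = lift_mx J'^T *m prevmx (p := id) (q := fun=> 1%N) P n ->
  D = J0 *m (Lmx R k m *m G k m.+1
             + G k m *m prevmx (p := id) (q := succn) (Lmx R k) m) *m J0^T /\
  C = J0 *m G k m *m prevmx (p := id) (q := predn) (G k) m *m J'^T.
Proof.
move=> f_sq Pm P_rec J0K Sm Sm2 Sm'.
have f_lift a b (A : 'M[R]_(a, b)) (u : 'cV_b) :
    map_mx f (lift_mx A *m u) = lift_mx A *m map_mx f u.
  apply/colP => i; rewrite [LHS]mxE !lift_mxE raddf_sum.
  by apply: eq_bigr => h _; rewrite /= linearZ mxE.
have := congr1 (fun u => lift_mx J0 *m map_mx f u) (square_recurrence k m).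
rewrite (_ : map_mx f (_ *: _) = var R k *: map_mx f (S m)); last first.
  by apply/colP => i; rewrite !mxE f_sq.
rewrite !map_mxD !f_lift Sm Sm2 Sm' -scalemxAr !mulmxDr !mulmxA -!lift_mxM J0K.
rewrite lift_mx1 mul1mx P_rec => /eqP; rewrite -subr_eq0 !opprD.
(* Two expansions of the variable times [P n] are subtracted, with the coefficients collected for
   each of the three indices. *)
rewrite addrACA [X in X + _]addrACA -!mulmxBl -!lift_mxB => /eqP.
move=> /(three_term_coef_eq0 Pm)[/subr0_eq-> /subr0_eq->].
by split; rewrite ?mulmxDr !mulmxA.
Qed.

End SquareRecurrence.

(** * The assumed expressions of S as sums over two parity classes *)

Section SquareDecomposition.
Variable R : realType.
Implicit Types (i j : bool).

(** The even and odd expressions of S share this shape, with (i, j) = (0, 0) and (1, 0): the two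
    classes differ in the parity of both exponents, so they agree in total parity. *)
Definition comb_sq i j n (u v : 'cV[bipoly R]_n) : 'cV[bipoly R]_n :=
  map_mx (lift_sq i j) u + map_mx (lift_sq (~~ i) (~~ j)) v.

Lemma comb_sq_even n (u v : 'cV[bipoly R]_n) :
  subst_sq_mx u + (var R 0 * var R 1) *: subst_sq_mx v = comb_sq false false u v.
Proof. by apply/colP => h; rewrite !mxE /lift_sq /= !expr0 !expr1 !mul1r. Qed.

Lemma comb_sq_odd n (u v : 'cV[bipoly R]_n) :
  var R 0 *: subst_sq_mx u + var R 1 *: subst_sq_mx v = comb_sq true false u v.
Proof. by apply/colP => h; rewrite !mxE /lift_sq /= !expr0 !expr1 mulr1 mul1r. Qed.

Lemma parity_comb_sq i j n (u v : 'cV[bipoly R]_n) h :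
  parity (i (+) j) (comb_sq i j u v h 0).
Proof.
move=> m hm; rewrite !mxE mcoeffD (@parity_lift_sq _ i j) //.
by rewrite (@parity_lift_sq _ (~~ i) (~~ j)) ?addr0 // addbN addNb negbK.
Qed.

Lemma part_comb_sq i j n (u v : 'cV[bipoly R]_n) :
  map_mx (part_sq i j) (comb_sq i j u v) = u.
Proof.
apply/colP => h; rewrite !mxE linearD /= !part_sq_lift_sq !eqxx.
by case: (i); rewrite addr0.
Qed.

Lemma part_comb_sqN i j n (u v : 'cV[bipoly R]_n) :
  map_mx (part_sq (~~ i) (~~ j)) (comb_sq i j u v) = v.
Proof.
apply/colP => h; rewrite !mxE linearD /= !part_sq_lift_sq !eqxx.
by case: (i); rewrite add0r.
Qed.

End SquareDecomposition.

(** * The moment functional, and invertibility of Gram matrices *)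

Section Moments.
Variable R : realType.

(** Finite moments make every polynomial integrable against W, so integration is additive on
    polynomials. *)
Lemma moment_functional (Omega : set (plane R)) (W : plane R -> R) :
  is_weight Omega W ->
  exists Lf : {scalar bipoly R},
    forall p, \int[@mu2 R]_(z in Omega) (ev z p * W z) = Lf p.
Proof.
move=> [mO _ _ intX _].
have evX z (m : multinom 2) : ev z (mpolyX R m) = z.1 ^+ m 0%R * z.2 ^+ m 1%R.
  rewrite /ev mevalX big_ord_recl big_ord1 /=.
  by have -> : lift ord0 ord0 = 1 :> 'I_2 by exact: val_inj.
have evlin z c p q : ev z (c *: p + q) * W z = c * (ev z p * W z) + ev z q * W z.
  by rewrite /ev mevalD mevalZ mulrDl mulrA.
have intZ c p : (@mu2 R).-integrable Omega (EFin \o (fun z => ev z p * W z)) ->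
    (@mu2 R).-integrable Omega (EFin \o (fun z => c * (ev z p * W z))).
  by move=> /(integrableZl mO c); apply: eq_integrable => // z _ /=; rewrite EFinM.
have int_p p : (@mu2 R).-integrable Omega (EFin \o (fun z => ev z p * W z)).
  elim/mpolyind: p => [|c m p _ _ IH].
    apply: (@eq_integrable _ _ _ _ _ _ (cst 0%E)) => //; last exact: integrable0.
    by move=> z _; rewrite /= /ev meval0 mul0r.
  have /(intZ c)/(integrableD mO)/(_ IH) :
      (@mu2 R).-integrable Omega (EFin \o (fun z => ev z (mpolyX R m) * W z)).
    by apply: eq_integrable (intX (m 0%R) (m 1%R)) => // z _ /=; rewrite evX.
  by apply: eq_integrable => // z _ /=; rewrite evlin EFinD.
pose F p := \int[@mu2 R]_(z in Omega) (ev z p * W z).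
have Flin : linear_for *%R F.
  move=> c p q; rewrite /F -RintegralZl // -RintegralD //; last exact: intZ.
  by apply: eq_Rintegral => z _; rewrite evlin.
by exists (HB.pack_for {scalar bipoly R} F (GRing.isLinear.Build R (bipoly R) R *%R F Flin)).
Qed.

(** A row v with v A = 0 makes the quadratic form vanish at its transpose. *)
Lemma sym_posdef_unitmx n (A : 'M[R]_n) : sym_posdef A -> A \in unitmx.
Proof.
move=> [_ Apos]; rewrite -row_free_unit; apply: inj_row_free => v vA.
apply/eqP; apply: contraT => v0.
by have := Apos v^T; rewrite trmx_eq0 trmxK vA mul0mx mxE ltxx => /(_ v0).
Qed.

(** Each row h has a single 1, in column 2h + j, and these columns are distinct. *)
Lemma JmxK i j n : Jmx R i j n *m (Jmx R i j n)^T = 1%:M.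
Proof.
apply/matrixP => a b; rewrite !mxE.
have aj : (a.*2 + j < (i + (j + n.*2)).+1)%N.
  by have := ltn_ord a; rewrite -!muln2; lia.
rewrite (bigD1 (Ordinal aj)) //= !mxE eqxx mul1r big1 ?addr0 => [|l la]; last first.
  by rewrite mxE -(inj_eq val_inj) /= in la *; rewrite (negbTE la) mul0r.
congr (nat_of_bool _)%:R; rewrite -(inj_eq val_inj) /= eqn_add2r.
by rewrite -!muln2 eqn_mul2r.
Qed.

End Moments.

(** * Assembly over the four pairs (i, j) *)

Theorem theorem5p1 (R : realType) (Omega : set (plane R)) (W : plane R -> R)
    (S : polysys R) (Phat : bool -> bool -> polysys R)
    (Dhat : bool -> bool -> 'I_2 -> forall n : nat, 'M[R]_n.+1)
    (Chat : bool -> bool -> 'I_2 -> forall n : nat, 'M[R]_(n.+1, n)) :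
  is_weight Omega W ->
  xy_symmetric Omega W ->
  is_mops Omega W S ->
  (forall i j : bool,
     is_mops (Omega_star Omega) (W_star W i j) (Phat i j)) ->
  (forall i j : bool, three_term (Phat i j) (Dhat i j) (Chat i j)) ->
  (forall n : nat,
     S n.*2 =
       subst_sq_mx (m := n.*2.+1) (bigP false false (Phat false false) n)
       + (var R 0 * var R 1) *:
         subst_sq_mx (prevmx (p := fun n => n.*2.+1) (q := fun=> 1%N)
                             (bigP true true (Phat true true)) n)) ->
  (forall n : nat,
     S n.*2.+1 =
       var R 0 *: subst_sq_mx (m := n.*2.+2) (bigP true false (Phat true false) n)
       + var R 1 *: subst_sq_mx (m := n.*2.+2) (bigP false true (Phat false true) n)) ->
  let L := Lmx R in
  let G := Gamma Omega W S in
  let J := Jmx R in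
  (* index n - 1 for each of the families L, Gamma and J *)
  let L' := fun k => prevmx (p := id) (q := succn) (L k) in
  let G' := fun k => prevmx (p := id) (q := predn) (G k) in
  let J00' := prevmx (p := id) (q := fun n => n.*2.-1) (J false false) in
  let J11' := prevmx (p := id) (q := fun n => n.*2.+1) (J true true) in
  let J10' := prevmx (p := id) (q := fun n => n.*2) (J true false) in
  let J01' := prevmx (p := id) (q := fun n => n.*2) (J false true) in
  forall (n : nat) (k : 'I_2),
    (Dhat false false k n =
       J false false n
         *m (L k n.*2 *m G k n.*2.+1 + G k n.*2 *m L' k n.*2)
         *m (J false false n)^T /\
     Chat false false k n =
       J false false n *m G k n.*2 *m G' k n.*2 *m (J00' n)^T) /\
    (Dhat true true k n =
       J true true n
         *m (L k n.*2.+2 *m G k n.*2.+3 + G k n.*2.+2 *m L k n.*2.+1)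
         *m (J true true n)^T /\
     Chat true true k n =
       J true true n *m G k n.*2.+2 *m G k n.*2.+1 *m (J11' n)^T) /\
    (Dhat true false k n =
       J true false n
         *m (L k n.*2.+1 *m G k n.*2.+2 + G k n.*2.+1 *m L k n.*2)
         *m (J true false n)^T /\
     Chat true false k n =
       J true false n *m G k n.*2.+1 *m G k n.*2 *m (J10' n)^T) /\
    (Dhat false true k n =
       J false true n
         *m (L k n.*2.+1 *m G k n.*2.+2 + G k n.*2.+1 *m L k n.*2)
         *m (J false true n)^T /\
     Chat false true k n =
       J false true n *m G k n.*2.+1 *m G k n.*2 *m (J01' n)^T).
Proof.
move=> weightW _ [S_monic S_orth S_posdef] Phat_mops Phat_rec S_even S_odd.
move=> L G J L' G' J00' J11' J10' J01' n k.
have [Lf Lf_int] := moment_functional weightW.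
have gramE a b (u : 'cV_a) (v : 'cV_b) : gram Omega W u v = fgram Lf u v.
  by apply/matrixP => i j; rewrite !mxE Lf_int.
pose P00 l : 'cV_(l.*2.+1) := bigP false false (Phat false false) l.
pose P10 l : 'cV_(l.*2.+2) := bigP true false (Phat true false) l.
pose P01 l : 'cV_(l.*2.+2) := bigP false true (Phat false true) l.
(* The (1, 1) family enters [S l.*2] with index l - 1, as the zero column for l = 0. *)
pose P11' l : 'cV_(l.*2.+1) := prevmx (p := fun n => n.*2.+1) (q := fun=> 1%N)
                                 (bigP true true (Phat true true)) l.
have evenE l : S l.*2 = comb_sq false false (P00 l) (P11' l).
  by rewrite S_even; apply: comb_sq_even.
have oddE l : S l.*2.+1 = comb_sq true false (P10 l) (P01 l).
  by rewrite S_odd; apply: comb_sq_odd.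
have S_parity l i : parity (odd l) (S l i 0).
  have [l' [el|el]] : exists l', l = l'.*2 \/ l = l'.*2.+1.
    by exists l./2; rewrite -{1 3}(odd_double_half l); case: odd; [right|left].
  - rewrite {}el in i *; rewrite odd_double evenE.
    exact: (@parity_comb_sq R false false).
  - rewrite {}el in i *; rewrite /= odd_double oddE.
    exact: (@parity_comb_sq R true false).
have S_rec k' l : var R k' *: S l = lift_mx (L k' l) *m S l.+1
    + lift_mx (G k' l) *m prevmx (p := id) (q := fun=> 1%N) S l.
  have -> : G k' l = fGamma Lf S k' l by case: l => //= l; rewrite !gramE.
  apply: symmetric_three_term => // [a b ab|a]; rewrite -gramE.
    exact: S_orth.
  exact/sym_posdef_unitmx/S_posdef.
have part00 l : map_mx (part_sq false false) (S l.*2) = P00 l.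
  by rewrite evenE part_comb_sq.
have part11 l : map_mx (part_sq true true) (S l.*2) = P11' l.
  by rewrite evenE (part_comb_sqN false false).
have part10 l : map_mx (part_sq true false) (S l.*2.+1) = P10 l.
  by rewrite oddE part_comb_sq.
have part01 l : map_mx (part_sq false true) (S l.*2.+1) = P01 l.
  by rewrite oddE (part_comb_sqN true false).
have monic i j : monic_sys (Phat i j) by case: (Phat_mops i j).
split; [|split; [|split]].
- apply: (@decimated_coefs R S G S_rec (part_sq false false) (Phat false false) k n
    n.*2 (Dhat false false k n) (Chat false false k n)
    (J false false n) (J false false n.+1) (J00' n)
    (part_sq_varM false false k) (monic false false)
    (Phat_rec false false k n) (JmxK R false false n) (part00 n) (part00 n.+1)).
  rewrite /J00'; case: (n) => [|n']; first by apply/colP => -[].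
  exact: part00.
- apply: (@decimated_coefs R S G S_rec (part_sq true true) (Phat true true) k n
    n.*2.+2 (Dhat true true k n) (Chat true true k n)
    (J true true n) (J true true n.+1) (J11' n)
    (part_sq_varM true true k) (monic true true)
    (Phat_rec true true k n) (JmxK R true true n) (part11 n.+1) (part11 n.+2)).
  rewrite [prev2 _ _]/= part11 /P11' /J11'.
  by case: (n) => [|n'] //=; rewrite mulmx0.
- apply: (@decimated_coefs R S G S_rec (part_sq true false) (Phat true false) k n
    n.*2.+1 (Dhat true false k n) (Chat true false k n)
    (J true false n) (J true false n.+1) (J10' n)
    (part_sq_varM true false k) (monic true false)
    (Phat_rec true false k n) (JmxK R true false n) (part10 n) (part10 n.+1)).
  rewrite /J10'; case: (n) => [|n']; first by apply/colP => -[].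
  exact: part10.
- apply: (@decimated_coefs R S G S_rec (part_sq false true) (Phat false true) k n
    n.*2.+1 (Dhat false true k n) (Chat false true k n)
    (J false true n) (J false true n.+1) (J01' n)
    (part_sq_varM false true k) (monic false true)
    (Phat_rec false true k n) (JmxK R false true n) (part01 n) (part01 n.+1)).
  rewrite /J01'; case: (n) => [|n']; first by apply/colP => -[].
  exact: part01.
Qed.
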